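(* Let $S$ be a finite non-abelian subset of $BS^{+}(1,3)$ with $k=|S|\geq 3$, and suppose that $S$ meets at least two distinct cosets of $\langle a\rangle$, i.e. in the coset decomposition $S=S_0\cup S_1\cup\cdots\cup S_t$ we have $t\geq 1$. Then $$|S^2|\geq \tfrac{7}{2}|S|-6.$$
   Context: $BS(1,3)=\langle a,b\mid ab=ba^3\rangle$ is the Baumslag–Solitar group. In it, $a^x b^m=b^m a^{3^m x}$ for all integers $x$ and $m\ge 0$, and every element of the form $b^m a^x$ ($m\ge 0$, $x\in\mathbb Z$) has a unique such representation. $BS^{+}(1,3)=\{b^m a^x: m\in\mathbb{Z}_{\ge 0},\ x\in\mathbb{Z}\}$ is a submonoid of $BS(1,3)$, with $(b^m a^x)(b^n a^y)=b^{m+n}a^{y+3^n x}$. For $A\subseteq\mathbb Z$ and $m\ge 0$, $b^m a^A=\{b^m a^x: x\in A\}$. For a set $S$ in a group, $S^2=\{st: s,t\in S\}$. A set $S$ is called non-abelian if the subgroup it generates is non-abelian (and abelian otherwise). Coset decomposition: for a finite nonempty $S\subseteq BS^{+}(1,3)$, let $m_0<m_1<\cdots<m_t$ be the distinct integers $m\ge 0$ with $S\cap b^m a^{\mathbb Z}\neq\emptyset$; put $S_i=S\cap b^{m_i}a^{\mathbb Z}=b^{m_i}a^{A_i}$ with $A_i\subseteq\mathbb Z$ finite, and $k_i=|S_i|$. Writing $S=S_0\cup S_1\cup\cdots\cup S_t$ always refers to this decomposition. *)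

(* Defs.v *)
From mathcomp Require Import all_boot all_order all_algebra.
Set Implicit Arguments. Unset Strict Implicit. Unset Printing Implicit Defensive.
Import Order.TTheory GRing.Theory Num.Theory.
Local Open Scope ring_scope.

(* Elements of BS^+(1,3): the pair (m, x) : nat * int stands for b^m a^x
   (unique normal form). *)
Definition bsp := (nat * int)%type.

(* (b^m a^x)(b^n a^y) = b^(m+n) a^(y + 3^n x) *)
Definition bsp_mul (u v : bsp) : bsp :=
  ((u.1 + v.1)%N, v.2 + (3 ^ v.1)%N%:Z * u.2).

Definition bsp_sq (S : seq bsp) : seq bsp :=
  undup [seq bsp_mul s t | s <- S, t <- S].

(* The group BS(1,3), realised concretely: (m, x) : int * rat stands for
   b^m a^x, with product (b^m a^x)(b^n a^y) = b^(m+n) a^(y + 3^n x).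
   This is Q >< Z; BS(1,3) = <a,b> is the subgroup Z[1/3] >< Z generated by
   a = (0,1), b = (1,0). *)
Definition bsg := (int * rat)%type.

Definition bsg_mul (u v : bsg) : bsg :=
  (u.1 + v.1, v.2 + (3%:~R : rat) ^ v.1 * u.2).
Definition bsg_one : bsg := (0, 0).
Definition bsg_inv (u : bsg) : bsg :=
  (- u.1, - ((3%:~R : rat) ^ (- u.1) * u.2)).

Definition bsp_emb (u : bsp) : bsg := (u.1%:Z, u.2%:~R).

Inductive gen_subgroup (P : bsg -> Prop) : bsg -> Prop :=
| gen_in g : P g -> gen_subgroup P g
| gen_one : gen_subgroup P bsg_one
| gen_mul g h : gen_subgroup P g -> gen_subgroup P h -> gen_subgroup P (bsg_mul g h)
| gen_inv g : gen_subgroup P g -> gen_subgroup P (bsg_inv g).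

Definition bsp_nonabelian (S : seq bsp) : Prop :=
  ~ (forall g h, gen_subgroup (fun g => exists2 s, s \in S & g = bsp_emb s) g ->
                 gen_subgroup (fun g => exists2 s, s \in S & g = bsp_emb s) h ->
                 bsg_mul g h = bsg_mul h g).

(* Main.v *)
Require Import Defs.
From mathcomp Require Import all_boot all_order all_algebra.
From mathcomp Require Import zify ring lra.
Import Order.TTheory GRing.Theory Num.Theory.
Local Open Scope ring_scope.
Set Implicit Arguments. Unset Strict Implicit.

(** Induction on [|S|], for sets with two noncommuting elements on at least two
levels (the level of [b^m a^x] is [m]). The products inside the top level and
those of the top two levels lie above every other product. If the top level has
[n >= 2] elements and there are three levels or more, these give at least
[(3n - 2) + (n + 1) >= 7n/2] new products, so the top level can be removed; a
single element [h] on top contributes at least four new products, two of which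
are [gh] and [hg] for a highest [g] that does not commute with [h]. If what
remains commutes, it has one element per level; its two lowest elements
[g0, g1] are then removed instead, which costs the seven products
[g0^2, g0 g1, g1^2, g1 g2, g0 h, g1 h, h g1]. With exactly two levels the bound
follows from [|A + B| >= |A| + |B| - 1] applied to classes modulo a power
of [3]. *)

(** * Sumsets of integers *)

Lemma exists_argmin (T : eqType) (f : T -> int) (l : seq T) :
  l != [::] -> exists2 x, x \in l & forall y, y \in l -> f x <= f y.
Proof.
elim: l => // a [|b l] IH _.
  by exists a; rewrite ?mem_head // => y; rewrite inE => /eqP->.
have [x xl xmin] := IH isT.
have [le_ax|lt_xa] := leP (f a) (f x).
  exists a; first exact: mem_head.
  by move=> y; rewrite inE => /orP[/eqP->//|/xmin]; lia.
exists x; first by rewrite inE xl orbT.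
by move=> y; rewrite inE => /orP[/eqP->|/xmin]; lia.
Qed.

Lemma exists_argmax (T : eqType) (f : T -> int) (l : seq T) :
  l != [::] -> exists2 x, x \in l & forall y, y \in l -> f y <= f x.
Proof.
move=> /(@exists_argmin T (fun x => - f x))[x xl xmin].
by exists x => // y /xmin; lia.
Qed.

(** With [a0] least in [A] and [b0] greatest in [B], the translates [a0 + B] and [A + b0] meet only
    in [a0 + b0]. *)
Lemma sumset_size (A B Q : seq int) :
  uniq A -> uniq B -> A != [::] -> B != [::] ->
  (forall a b, a \in A -> b \in B -> a + b \in Q) ->
  (size A + size B <= (size Q).+1)%N.
Proof.
move=> uA uB A0 B0 AB.
have [a0 a0A a0min] := @exists_argmin int id A A0.
have [b0 b0B b0max] := @exists_argmax int id B B0.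
pose l : seq int := [seq a0 + b | b <- B] ++ [seq a + b0 | a <- rem a0 A].
have ul : uniq l.
  rewrite cat_uniq !map_inj_uniq ?rem_uniq ?uB ?andbT //=; last 2 first.
  - by move=> x y; lia.
  - by move=> x y; lia.
  apply/hasPn => x /mapP[a]; rewrite mem_rem_uniq // inE => /andP[na aA] ->.
  apply/negP => /mapP[b bB e].
  by have := a0min _ aA; have := b0max _ bB; move: na => /=; lia.
have : (size l <= size Q)%N.
  apply: uniq_leq_size => // x; rewrite mem_cat => /orP[] /mapP[y yl ->].
    exact: AB.
  by apply: AB => //; apply: mem_rem yl.
have : (0 < size A)%N by case: (A) A0.
have -> : size l = (size B + (size A).-1)%N by rewrite size_cat !size_map size_rem.
lia.
Qed.

(** Descent on the absolute value of a nonzero entry: as long as [r] divides every entry, all are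
    divided by [r]. This normalises a set so that a class other than the multiples of [r] occurs. *)
Lemma divide_common_powers (r : nat) (C : seq int) :
  (1 < r)%N -> has (fun c => c != 0) C ->
  exists k : int, exists C' : seq int,
    [/\ k != 0, C = [seq k * c | c <- C'] & has (fun c => ~~ (r%:Z %| c)%Z) C'].
Proof.
move=> r1 /hasP[c]; have [n] := ubnP (`|c|%N).
elim: n C c => // n IH C c ltn cC c0.
have [h|/hasPn h] := boolP (has (fun c => ~~ (r%:Z %| c)%Z) C).
  by exists 1, C; split=> //; rewrite -[LHS]map_id; apply: eq_map => x; rewrite mul1r.
have hd x : x \in C -> r%:Z * (x %/ r%:Z)%Z = x.
  by move=> /h; rewrite negbK mulrC => /divzK.
have [||k [C' [k0 eC hC]]] := IH [seq (x %/ r%:Z)%Z | x <- C] (c %/ r%:Z)%Z _ (map_f _ cC).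
- have := hd _ cC; set q := (c %/ _)%Z => e; nia.
- by apply: contraNneq c0 => e; rewrite -(hd _ cC) e mulr0.
exists (r%:Z * k), C'; split=> //; first by rewrite mulf_neq0 //; lia.
have -> : C = [seq r%:Z * y | y <- [seq (x %/ r%:Z)%Z | x <- C]].
  rewrite -map_comp -[LHS]map_id; apply/eq_in_map => x xC /=; exact/esym/hd.
by rewrite eC -map_comp; apply: eq_map => x /=; rewrite mulrA.
Qed.

(** Adding a multiple of [r] does not change divisibility by [r], so the multiples and the
    nonmultiples in [A] have disjoint sumsets with [r * B]. Each is bounded by [sumset_size]. *)
Lemma divisible_sumset_size (r : nat) (A B Q : seq int) :
  (1 < r)%N -> uniq A -> uniq B -> B != [::] ->
  has (fun a => (r%:Z %| a)%Z) A -> has (fun a => ~~ (r%:Z %| a)%Z) A ->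
  (forall a b, a \in A -> b \in B -> a + r%:Z * b \in Q) ->
  (size A + 2 * size B <= (size Q).+2)%N.
Proof.
move=> r1 uA uB B0 hA1 hA2 AB.
pose d := fun a => (r%:Z %| a)%Z.
have urB : uniq [seq r%:Z * b | b <- B] by rewrite map_inj_uniq // => x y; nia.
have rB0 : [seq r%:Z * b | b <- B] != [::] by case: (B) B0.
have dD a b : d (a + r%:Z * b) = d a by rewrite /d rpredDr // dvdz_mulr.
have h1 : (size (filter d A) + size B <= (size (filter d Q)).+1)%N.
  rewrite -(size_map ( *%R r%:Z) B); apply: sumset_size => //.
  - exact: filter_uniq.
  - by rewrite -has_filter.
  move=> a _ + /mapP[b bB ->]; rewrite !mem_filter => /andP[da aA].
  by rewrite dD da AB.
have h2 : (size (filter (predC d) A) + size B <= (size (filter (predC d) Q)).+1)%N.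
  rewrite -(size_map ( *%R r%:Z) B); apply: sumset_size => //.
  - exact: filter_uniq.
  - by rewrite -has_filter.
  move=> a _ + /mapP[b bB ->]; rewrite !mem_filter /= => /andP[da aA].
  by rewrite dD da AB.
move: h1 h2; rewrite !size_filter.
have := count_predC d A; have := count_predC d Q; lia.
Qed.

(** An affine change of variable brings 0 and a nonmultiple of [r] into [A]; then
    [divisible_sumset_size] applies with both sets equal. *)
Lemma dilate_sumset_size (r : nat) (A Q : seq int) :
  (1 < r)%N -> uniq A -> A != [::] ->
  (forall a b, a \in A -> b \in A -> a + r%:Z * b \in Q) ->
  (3 * size A <= (size Q).+2)%N.
Proof.
move=> r1 uA A0 AQ.
have /hasP[a0 a0A _] : has predT A by rewrite has_predT; case: (A) A0.
pose C : seq int := [seq a - a0 | a <- A].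
have [h|/hasPn h] := boolP (has (fun c => c != 0) C); last first.
  have : (size A <= size [:: a0])%N.
    apply: uniq_leq_size => // a aA; rewrite inE.
    by have := h _ (map_f (fun a => a - a0) aA); lia.
  have : (size [:: (a0 + r%:Z * a0)%R] <= size Q)%N.
    by apply: uniq_leq_size => // x; rewrite inE => /eqP->; apply: AQ.
  by move=> /=; lia.
have [k [C' [k0 eC hC]]] := divide_common_powers r1 h.
have sC : size C' = size A by rewrite -(size_map ( *%R k)) -eC size_map.
have uC : uniq C.
  by rewrite map_inj_uniq // => x y; lia.
have uC' : uniq C' by move: uC; rewrite eC; apply: map_uniq.
have inC c : c \in C' -> k * c + a0 \in A.
  move=> /(map_f ( *%R k)); rewrite -eC => /mapP[a aA ->].
  by rewrite subrK.
(* Only the size of [Q'] matters, so rounding on entries that are not of the required form does no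
   harm. *)
pose Q' : seq int := [seq ((x - a0 - r%:Z * a0) %/ k)%Z | x <- Q].
have C'0 : C' != [::] by case: (C') hC.
have zC' : 0 \in C'.
  have : 0 \in C by apply/mapP; exists a0 => //; rewrite subrr.
  rewrite eC => /mapP[c cC' /esym/eqP]; rewrite mulf_eq0 (negPf k0) /=.
  by move=> /eqP<-.
have : (size C' + 2 * size C' <= (size Q').+2)%N.
  apply: (@divisible_sumset_size r) => //.
    by apply/hasP; exists 0 => //; rewrite dvdz0.
  move=> a b aC bC; apply/mapP; exists ((k * a + a0) + r%:Z * (k * b + a0)).
    by apply: AQ; apply: inC.
  have -> : k * a + a0 + r%:Z * (k * b + a0) - a0 - r%:Z * a0
     = (a + r%:Z * b) * k by ring.
  by rewrite mulzK.
have -> : size Q' = size Q by rewrite size_map.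
by rewrite sC; lia.
Qed.

(** The map [x -> r * x + w] multiplies the displacement [(r - 1) * x + w] by [r], so on a finite
    invariant set the displacement of largest absolute value is 0. *)
Lemma dilate_invariant_fixed (r w : int) (A : seq int) :
  1 < r -> (forall a, a \in A -> r * a + w \in A) ->
  forall a, a \in A -> (r - 1) * a + w = 0.
Proof.
move=> r1 hA.
have [->//|A0] := eqVneq A [::].
have [m mA mmax] := @exists_argmax int (fun a => `|(r - 1) * a + w|) A A0.
have e : (r - 1) * (r * m + w) + w = r * ((r - 1) * m + w) by ring.
have h := mmax _ (hA _ mA); rewrite e normrM gtr0_norm in h; last by lia.
have : (r - 1) * m + w = 0 by move: h; move: (_ * m + _) => t h; case: (ltrP t 0) h => t0; [rewrite ltr0_norm //|rewrite ger0_norm //]; nia.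
by move=> m0 a /mmax; rewrite m0; lia.
Qed.

(** * The monoid and its commutation relation *)

(** The exponent set $A$ with $S\cap b^m a^{\mathbb Z}=b^m a^A$. *)
Definition slice (m : nat) (S : seq bsp) : seq int :=
  [seq s.2 | s <- S & s.1 == m].

Lemma mem_slice m S x : (x \in slice m S) = ((m, x) \in S).
Proof.
apply/mapP/idP => [[[n y]]|xS]; last by exists (m, x) => //; rewrite mem_filter eqxx.
by rewrite mem_filter /= => /andP[/eqP<- yS] ->.
Qed.

Lemma slice_uniq m S : uniq S -> uniq (slice m S).
Proof.
move=> uS; rewrite map_inj_in_uniq ?filter_uniq // => [[a x] [b y]].
by rewrite !mem_filter /= => /andP[/eqP-> _] /andP[/eqP-> _] ->.
Qed.

Lemma mem_bsp_sq S s t : s \in S -> t \in S -> bsp_mul s t \in bsp_sq S.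
Proof. by move=> sS tS; rewrite mem_undup allpairs_f. Qed.

Lemma bsp_sqP S u :
  u \in bsp_sq S -> exists s, exists t, [/\ s \in S, t \in S & u = bsp_mul s t].
Proof. by rewrite mem_undup => /allpairsP[[s t] /= [sS tS ->]]; exists s, t. Qed.

Lemma slice_sq S m n a b : a \in slice m S -> b \in slice n S ->
  b + (3 ^ n)%N%:Z * a \in slice (m + n) (bsp_sq S).
Proof. by rewrite !mem_slice => aS bS; apply: (@mem_bsp_sq S (m, a) (n, b)). Qed.

Lemma slices3_size (Q : seq bsp) m1 m2 m3 : (m1 < m2)%N -> (m2 < m3)%N ->
  (size (slice m1 Q) + size (slice m2 Q) + size (slice m3 Q) <= size Q)%N.
Proof.
move=> h12 h23; rewrite !size_map !size_filter.
by elim: Q => //= s Q IH; lia.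
Qed.

(** Counts an explicit list [l] of products that are gained in passing from [L] to [S]. *)
Lemma sq_size_add (S L l : seq bsp) : {subset L <= S} -> uniq l ->
  {subset l <= bsp_sq S} ->
  (forall u v, u \in L -> v \in L -> bsp_mul u v \notin l) ->
  (size (bsp_sq L) + size l <= size (bsp_sq S))%N.
Proof.
move=> LS ul lS nl; rewrite -size_cat; apply: uniq_leq_size.
  rewrite cat_uniq undup_uniq ul andbT /=; apply/hasPn => x xl; apply/negP.
  by move=> /bsp_sqP[s [t [sL tL e]]]; move: (nl _ _ sL tL); rewrite -e xl.
move=> x; rewrite mem_cat => /orP[/bsp_sqP[s [t [/LS sL /LS tL ->]]]|/lS//].
exact: mem_bsp_sq.
Qed.

Lemma pow3_gt0 n : 0 < (3 ^ n)%N%:Z.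
Proof. by have := expn_gt0 3 n; lia. Qed.

Lemma pow3_gt1 n : (0 < n)%N -> 1 < (3 ^ n)%N%:Z.
Proof. by case: n => // n _; rewrite expnS; have := pow3_gt0 n; lia. Qed.

(* Up to sign, [(3^h.1 - 1) (3^s.1 - 1)] times the difference of the fixed points
   of [s] and [h], seen as affine maps. *)
Definition defect (h s : bsp) : int :=
  ((3 ^ h.1)%N%:Z - 1) * s.2 - h.2 * ((3 ^ s.1)%N%:Z - 1).

(** Both [s.2] and [3 ^ s.1 - 1] obey the rule [f (u v) = f v + 3 ^ v.1 * f u], and the defect is a
    linear combination of them. Elements of defect 0 are thus closed under products. *)
Lemma defect_mul h u v :
  defect h (bsp_mul u v) = defect h v + (3 ^ v.1)%N%:Z * defect h u.
Proof. by rewrite /defect /bsp_mul /= expnD PoszM; ring. Qed.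

(** The defect is exactly the difference of the exponents of $a$ in [s h] and in [h s]. *)
Lemma defect_comm h s : (defect h s == 0) = (bsp_mul h s == bsp_mul s h).
Proof.
rewrite /defect /bsp_mul -pair_eqE /pair_eq /= addnC eqxx /=.
by apply/eqP/eqP => e; nia.
Qed.

Lemma defect_self h : defect h h = 0.
Proof. by rewrite /defect; ring. Qed.

(** On a fixed level the defect is affine in the exponent of $a$, with slope [3 ^ h.1 - 1], nonzero
    for [h] of positive level. *)
Lemma defect_inj h s t : (0 < h.1)%N -> s.1 = t.1 -> defect h s = defect h t -> s = t.
Proof.
case: s t => [m x] [n y] /pow3_gt1 h1 /= <-; rewrite /defect /= => e.
by congr pair; nia.
Qed.

(** Two elements commuting with a common element of positive level commute: [s t] and [t s] have the
    same level and both have defect 0. *)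
Lemma defect0_comm h s t : (0 < h.1)%N -> defect h s = 0 -> defect h t = 0 ->
  bsp_mul s t = bsp_mul t s.
Proof.
move=> h1 s0 t0; apply: (@defect_inj h) => //=; first exact: addnC.
by rewrite !defect_mul s0 t0 !mulr0.
Qed.

Definition noncommuting (S : seq bsp) : bool :=
  has (fun s => has (fun t => bsp_mul s t != bsp_mul t s) S) S.

Lemma noncommuting_defect S h : (0 < h.1)%N -> noncommuting S ->
  exists2 s, s \in S & defect h s != 0.
Proof.
move=> h1 ncS; apply/hasP; apply: contraLR ncS => /hasPn nS.
apply/hasPn => s sS; apply/hasPn => t tS; rewrite negbK; apply/eqP.
by apply: (@defect0_comm h) => //; apply/eqP; rewrite -[_ == _]negbK nS.
Qed.

Lemma defect_noncommuting S h s : h \in S -> s \in S -> defect h s != 0 ->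
  noncommuting S.
Proof.
move=> hS sS; rewrite defect_comm => n.
by apply/hasP; exists h => //; apply/hasP; exists s.
Qed.

Lemma commuting_defect S h s : ~~ noncommuting S -> h \in S -> s \in S -> defect h s = 0.
Proof. by move=> cS hS sS; apply/eqP; apply: contraNT cS; apply: defect_noncommuting. Qed.

(** * From the generated subgroup to noncommuting elements *)

Lemma bsg_mulA : associative bsg_mul.
Proof.
move=> [a x] [b y] [c z]; rewrite /bsg_mul /= addrA; congr pair.
by rewrite expfzDr //; ring.
Qed.

Lemma bsg_mul1g : left_id bsg_one bsg_mul.
Proof. by move=> [a x]; rewrite /bsg_mul /= add0r mulr0 addr0. Qed.

Lemma bsg_mulg1 : right_id bsg_one bsg_mul.
Proof. by move=> [a x]; rewrite /bsg_mul /= addr0 add0r expr0z mul1r. Qed.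

Lemma bsg_mulVg g : bsg_mul (bsg_inv g) g = bsg_one.
Proof.
case: g => a x; rewrite /bsg_mul /bsg_inv /bsg_one /= addNr; congr pair.
by rewrite mulrN mulrA -expfzDr // subrr expr0z mul1r subrr.
Qed.

Lemma bsg_mulgV g : bsg_mul g (bsg_inv g) = bsg_one.
Proof. by case: g => a x; rewrite /bsg_mul /bsg_inv /bsg_one /= subrr addNr. Qed.

Lemma bsp_emb_mul u v : bsp_emb (bsp_mul u v) = bsg_mul (bsp_emb u) (bsp_emb v).
Proof.
rewrite /bsp_emb /bsp_mul /bsg_mul /= PoszD; congr pair.
by rewrite intrD intrM -exprnP -pmulrn natrX.
Qed.

Lemma gen_subgroup_commute (P : bsg -> Prop) h :
  (forall s, P s -> bsg_mul s h = bsg_mul h s) ->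
  forall g, gen_subgroup P g -> bsg_mul g h = bsg_mul h g.
Proof.
move=> Ph g; elim=> {g} [g /Ph//||g k _ eg _ ek|g _ eg].
- by rewrite bsg_mul1g bsg_mulg1.
- by rewrite -bsg_mulA ek bsg_mulA eg bsg_mulA.
rewrite -[LHS]bsg_mulg1 -(bsg_mulgV g) bsg_mulA -(bsg_mulA _ h g) -eg.
by rewrite bsg_mulA bsg_mulVg bsg_mul1g.
Qed.

(** The centraliser of an element is a subgroup, so commutation passes from the generators to the
    generated subgroup, first in one argument and then in the other. *)
Lemma nonabelian_noncommuting (S : seq bsp) : bsp_nonabelian S -> noncommuting S.
Proof.
move=> nS; have [//|/hasPn cS] := boolP (noncommuting S); case: nS => g h.
have comm s t : s \in S -> t \in S -> bsp_mul s t = bsp_mul t s.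
  by move=> /cS/hasPn h1 /h1; rewrite negbK => /eqP.
move=> gS hS; apply: gen_subgroup_commute gS => s [s' s'S ->].
apply/esym; apply: gen_subgroup_commute hS => t [t' t'S ->].
by rewrite -!bsp_emb_mul comm.
Qed.

(** * Two levels *)

(* When all of [A1] is divisible by [r], the sums with the elements of [A0] not
   divisible by [r] are counted separately, both in [Q0] and in [Q1]. *)
Lemma primitive_two_level_size (r : nat) (A0 A1 Q0 Q1 : seq int) :
  (1 < r)%N -> uniq A0 -> uniq A1 -> A0 != [::] -> 0 \in A1 ->
  has (fun c => ~~ (r%:Z %| c)%Z) (A0 ++ A1) ->
  (forall a b, a \in A0 -> b \in A0 -> a + b \in Q0) ->
  (forall a b, a \in A0 -> b \in A1 -> a + b \in Q1) ->
  (forall a b, a \in A0 -> b \in A1 -> b + r%:Z * a \in Q1) ->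
  (7 * size A0 + size A1 <= 2 * (size Q0 + size Q1) + 8)%N.
Proof.
move=> r1 u0 u1 n0 z1 hnd H00 H01 H10.
have n1 : A1 != [::] by case: (A1) z1.
have p0 : (0 < size A0)%N by case: (A0) n0.
have c00 := sumset_size u0 u0 n0 n0 H00.
pose d := fun a : int => (r%:Z %| a)%Z.
have [h1|/hasPn h1] := boolP (has (fun c => ~~ d c) A1).
  have : (size A1 + 2 * size A0 <= (size Q1).+2)%N.
    apply: (@divisible_sumset_size r) => //; last by move=> *; apply: H10.
    by apply/hasP; exists 0 => //; apply: dvdz0.
  by lia.
have dA1 a : a \in A1 -> d a by move=> /h1; rewrite negbK.
have hA0 : has (fun c => ~~ d c) A0.
  by move: hnd; rewrite has_cat => /orP[//|/hasP[c /dA1 dc]]; rewrite -/(d c) dc.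
have dD a b : d a -> d (b + a) = d b by move=> da; apply: rpredDr.
pose ud := filter_uniq d u0; pose und := filter_uniq (predC d) u0.
have n0' : filter (predC d) A0 != [::] by rewrite -has_filter.
have urB : uniq [seq r%:Z * b | b <- A0] by rewrite map_inj_uniq // => x y; nia.
have rB0 : [seq r%:Z * b | b <- A0] != [::] by case: (A0) n0.
have c1 : (size A1 + size A0 <= (size (filter d Q1)).+1)%N.
  rewrite -(size_map ( *%R r%:Z) A0); apply: sumset_size => //.
  move=> a _ aA /mapP[b bA ->]; rewrite mem_filter H10 // andbT.
  by rewrite dD; [apply: dA1 | rewrite /d dvdz_mulr].
have c2 : (size (filter (predC d) A0) + size A1 <= (size (filter (predC d) Q1)).+1)%N.
  apply: sumset_size => // a b; rewrite !mem_filter /= => /andP[da aA] bA.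
  by rewrite H01 // andbT dD // dA1.
move: c1 c2; rewrite !size_filter.
have := count_predC d A0; have := count_predC d Q0; have := count_predC d Q1.
have [hd|hd] := boolP (has d A0); last first.
  by rewrite has_count in hd; lia.
have n0d : filter d A0 != [::] by rewrite -has_filter.
(* With [p] multiples and [q] nonmultiples of [r] in [A0], splitting gives [3p + q - 2] as a bound
   for [Q0], while [c00] gives [2(p + q) - 1]. Their mean, together with [c1] and [c2], produces the
   equal coefficients 7. *)
have : (size (filter d A0) + size (filter d A0) <= (size (filter d Q0)).+1)%N.
  apply: sumset_size => // a b; rewrite !mem_filter => /andP[da aA] /andP[db bA].
  by rewrite H00 // andbT dD.
have : (size (filter (predC d) A0) + size (filter d A0)
         <= (size (filter (predC d) Q0)).+1)%N.
  apply: sumset_size => // a b; rewrite !mem_filter /= => /andP[da aA] /andP[db bA].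
  by rewrite H00 // andbT dD.
by rewrite !size_filter; lia.
Qed.

(** Reduction to the primitive case by translating [A1] and dividing both sets by the same [k].
    Translating [A1] shifts both families in [Q1] equally, whereas a shift of [A0] would move them
    by different amounts. *)
Lemma two_level_sumset_size (r : nat) (A0 A1 Q0 Q1 : seq int) :
  (1 < r)%N -> uniq A0 -> uniq A1 -> A0 != [::] -> A1 != [::] ->
  (forall a b, a \in A0 -> b \in A0 -> a + b \in Q0) ->
  (forall a b, a \in A0 -> b \in A1 -> a + b \in Q1) ->
  (forall a b, a \in A0 -> b \in A1 -> b + r%:Z * a \in Q1) ->
  (7 * size A0 + size A1 <= 2 * (size Q0 + size Q1) + 8)%N.
Proof.
move=> r1 u0 u1 n0 n1 H00 H01 H10.
have /hasP[c cA _] : has predT A1 by rewrite has_predT; case: (A1) n1.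
pose B1 : seq int := [seq a - c | a <- A1].
have z1 : 0 \in B1 by apply/mapP; exists c => //; rewrite subrr.
have uB1 : uniq B1 by rewrite map_inj_uniq // => x y; lia.
have sB1 : size B1 = size A1 by rewrite size_map.
(* If every entry is 0, both sets have at most one element, and the constant 8 covers [7 + 1]. *)
have [h|/hasPn h] := boolP (has (fun x => x != 0) (A0 ++ B1)); last first.
  have h' x : x \in A0 ++ B1 -> x \in [:: 0].
    by move=> /h; rewrite negbK inE.
  have : (size A0 <= size [:: 0%Z])%N.
    by apply: uniq_leq_size => // x xA; apply: h'; rewrite mem_cat xA.
  have : (size B1 <= size [:: 0%Z])%N.
    by apply: uniq_leq_size => // x xA; apply: h'; rewrite mem_cat xA orbT.
  by rewrite sB1 /=; lia.
have [k [C [k0 eC hC]]] := divide_common_powers r1 h.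
pose C0 := take (size A0) C; pose C1 := drop (size A0) C.
have eA0 : A0 = [seq k * x | x <- C0].
  by rewrite map_take -eC take_size_cat.
have eB1 : B1 = [seq k * x | x <- C1].
  by rewrite map_drop -eC drop_size_cat.
have sC0 : size C0 = size A0 by rewrite [in RHS]eA0 size_map.
have sC1 : size C1 = size A1 by rewrite -sB1 [in RHS]eB1 size_map.
have i0 x : x \in C0 -> k * x \in A0 by rewrite [in X in _ -> X]eA0; apply: map_f.
have i1 x : x \in C1 -> k * x + c \in A1.
  move=> /(map_f ( *%R k)); rewrite -eB1 => /mapP[a aA ->].
  by rewrite subrK.
pose P0 : seq int := [seq (x %/ k)%Z | x <- Q0].
pose P1 : seq int := [seq ((x - c) %/ k)%Z | x <- Q1].
have sP0 : size P0 = size Q0 by rewrite size_map.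
have sP1 : size P1 = size Q1 by rewrite size_map.
rewrite -sC0 -sC1 -sP0 -sP1; apply: (@primitive_two_level_size r) => //.
- by move: u0; rewrite [in X in X -> _]eA0; apply: map_uniq.
- by move: uB1; rewrite [in X in X -> _]eB1; apply: map_uniq.
- by rewrite -size_eq0 sC0 size_eq0.
- move: z1; rewrite eB1 => /mapP[x xC /esym/eqP].
  by rewrite mulf_eq0 (negPf k0) => /eqP<-.
- by rewrite cat_take_drop.
- move=> a b aC bC; apply/mapP; exists (k * a + k * b); first exact: H00 (i0 _ aC) (i0 _ bC).
  by rewrite -mulrDr mulrC mulzK.
- move=> a b aC bC; apply/mapP; exists (k * a + (k * b + c)).
    exact: H01 (i0 _ aC) (i1 _ bC).
  have -> : k * a + (k * b + c) - c = (a + b) * k by ring.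
  by rewrite mulzK.
- move=> a b aC bC; apply/mapP; exists (k * b + c + r%:Z * (k * a)).
    exact: H10 (i0 _ aC) (i1 _ bC).
  have -> : k * b + c + r%:Z * (k * a) - c = (b + r%:Z * a) * k by ring.
  by rewrite mulzK.
Qed.

Lemma slice_neq0 S s : s \in S -> slice s.1 S != [::].
Proof. by case: s => m x; rewrite -mem_slice; case: slice. Qed.

Lemma slice_square_size (S : seq bsp) (m : nat) : uniq S -> (0 < m)%N -> slice m S != [::] ->
  (3 * size (slice m S) <= (size (slice (m + m) (bsp_sq S))).+2)%N.
Proof.
move=> uS m0 nS; apply: (@dilate_sumset_size (3 ^ m)) => //.
- by have := pow3_gt1 m0; lia.
- exact: slice_uniq.
by move=> a b aS bS; apply: slice_sq.
Qed.

Lemma slice_mixed_size S m n : uniq S -> slice m S != [::] -> slice n S != [::] ->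
  (size (slice m S) + size (slice n S) <= (size (slice (m + n) (bsp_sq S))).+1)%N.
Proof.
move=> uS mS nS.
have u0 : uniq [seq (3 ^ n)%N%:Z * x | x <- slice m S].
  by rewrite map_inj_uniq ?slice_uniq // => x y; have := pow3_gt0 n; nia.
rewrite -(size_map ( *%R (3 ^ n)%N%:Z) (slice m S)) addnC.
apply: sumset_size => //; first exact: slice_uniq.
  by rewrite -size_eq0 size_map size_eq0.
by move=> a _ aS /mapP[b bS ->]; apply: slice_sq.
Qed.

(** Products lie on the levels [2m], [m + M] and [2M]. For [m > 0] the separate bounds add up to
    [4 |S| - 5]. On level 0 the product is plain addition and the bound for dilates is lost, so the
    two lower levels are estimated jointly. *)
Lemma two_level_size (S : seq bsp) (m M : nat) : uniq S -> (m < M)%N ->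
  slice m S != [::] -> slice M S != [::] ->
  (forall s, s \in S -> (s.1 == m) || (s.1 == M)) ->
  (7 * size S <= 2 * size (bsp_sq S) + 12)%N.
Proof.
move=> uS ltmM nm nM lev.
have sS : size S = (size (slice m S) + size (slice M S))%N.
  rewrite !size_map !size_filter -(count_predC (fun s => s.1 == m)); congr addn.
  by apply: eq_in_count => s /lev /=; lia.
have c3 : (size (slice (m + m) (bsp_sq S)) + size (slice (m + M) (bsp_sq S))
           + size (slice (M + M) (bsp_sq S)) <= size (bsp_sq S))%N.
  by apply: slices3_size; lia.
have cM : (3 * size (slice M S) <= (size (slice (M + M) (bsp_sq S))).+2)%N.
  by apply: slice_square_size => //; lia.
case: (posnP m) => [m0|m0]; last first.
  by have := slice_square_size uS m0 nm; have := slice_mixed_size uS nm nM; lia.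
have : (7 * size (slice m S) + size (slice M S) <=
  2 * (size (slice (m + m) (bsp_sq S)) + size (slice (m + M) (bsp_sq S))) + 8)%N.
  apply: (@two_level_sumset_size (3 ^ M)); rewrite ?slice_uniq //.
  - have : (0 < M)%N by lia.
    by move=> /pow3_gt1; lia.
  - move=> a b aS bS; have := slice_sq bS aS.
    by rewrite [in (3 ^ m)%N]m0 expn0 mul1r.
  - move=> a b aS bS; have := slice_sq bS aS.
    by rewrite [in (3 ^ m)%N]m0 expn0 mul1r addnC.
  - by move=> a b aS bS; apply: slice_sq.
by lia.
Qed.

(** * The top level *)

Definition level (s : bsp) : nat := s.1.

Lemma level_mul u v : level (bsp_mul u v) = (level u + level v)%N.
Proof. by []. Qed.

Lemma exists_lowest (S : seq bsp) :
  S != [::] -> exists2 g, g \in S & forall s, s \in S -> (level g <= level s)%N.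
Proof.
by move=> /(@exists_argmin _ (fun s : bsp => (level s)%:Z))[g gS h]; exists g => // s /h; lia.
Qed.

Lemma exists_highest (S : seq bsp) :
  S != [::] -> exists2 g, g \in S & forall s, s \in S -> (level s <= level g)%N.
Proof.
by move=> /(@exists_argmax _ (fun s : bsp => (level s)%:Z))[g gS h]; exists g => // s /h; lia.
Qed.

(** If level [n] has two elements, the sumset bound suffices. If it has only [b], the products with
    [b] on the left and on the right form two sets of the size of [slice m S]. Were there no further
    product, these would coincide, and [slice m S] would be invariant under an expanding affine map,
    which has only one fixed point. *)
Lemma slice_above_size S m n : uniq S -> (n < m)%N -> (0 < n)%N ->
  (1 < size (slice m S))%N -> slice n S != [::] ->
  (size (slice m S) < size (slice (m + n) (bsp_sq S)))%N.
Proof.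
move=> uS nm n0 szm nn.
have nnm : slice m S != [::] by case: slice szm.
have := slice_mixed_size uS nnm nn.
case e : (slice n S) nn => [|b [|b' B]] // _; last by move=> /=; lia.
move=> _; rewrite ltnNge; apply/negP => le.
have bS : b \in slice n S by rewrite e mem_head.
have um := slice_uniq m uS.
pose l : seq int := [seq b + (3 ^ n)%N%:Z * a | a <- slice m S].
have ul : uniq l.
  by rewrite map_inj_uniq // => x y; have := pow3_gt0 n; nia.
have lQ : {subset l <= slice (m + n) (bsp_sq S)}.
  by move=> _ /mapP[a aS ->]; apply: slice_sq.
pose k : seq int := [seq a + (3 ^ m)%N%:Z * b | a <- slice m S].
have uk : uniq k by rewrite map_inj_uniq // => x y; lia.
have kQ : {subset k <= slice (m + n) (bsp_sq S)}.
  by move=> _ /mapP[a aS ->]; rewrite addnC; apply: slice_sq.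
have sk : size k = size (slice m S) by rewrite size_map.
have [|_ eq] := uniq_min_size uk kQ; first by rewrite sk.
have inv a : a \in slice m S ->
    (3 ^ n)%N%:Z * a + (b - (3 ^ m)%N%:Z * b) \in slice m S.
  move=> aS; have : b + (3 ^ n)%N%:Z * a \in k by rewrite eq; apply: lQ; apply: map_f.
  by case/mapP => a' a'S e'; have -> : (3 ^ n)%N%:Z * a + (b - (3 ^ m)%N%:Z * b) = a' by lia.
have fix_ := dilate_invariant_fixed (pow3_gt1 n0) inv.
case e2 : (slice m S) szm um fix_ => [|x [|y A]] //= _ /andP[].
rewrite inE negb_or => /andP[xy _] _ h.
have := h x; have := h y; rewrite !inE !eqxx orbT => /(_ isT) hy /(_ isT) hx.
by have := pow3_gt1 n0; move/eqP: xy; nia.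
Qed.

Lemma neq_level u v : level u <> level v -> u != v.
Proof. by move=> n; apply/eqP => e; apply: n; rewrite e. Qed.

Ltac level_lia :=
  repeat match goal with
  | H : is_true (leq _ _) |- _ => revert H
  | H : @eq nat _ _ |- _ => revert H
  end; clear; rewrite ?level_mul; intros; lia.

(** * A single element on the top level *)

Section SingleTop.

Variables (S : seq bsp) (h h' : bsp).
Hypotheses (uS : uniq S) (hS : h \in S).
Hypotheses (h'S : h' \in S) (h'h : (level h' < level h)%N).
Hypothesis (topS : forall s, s \in S -> s != h -> (level s <= level h')%N).
Hypothesis (three : exists2 s, s \in S & (level s < level h')%N).

Let memL s : s \in rem h S -> s \in S /\ (level s <= level h')%N.
Proof. by rewrite mem_rem_uniq // inE => /andP[n sS]; split=> //; apply: topS. Qed.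

Let h0 : (0 < level h)%N.
Proof. level_lia. Qed.

(** This rule and the next tell products [u h] from products [h u]: only multiplication by [h] on
    the right scales the defect. *)
Let defect_mulr u : defect h (bsp_mul u h) = (3 ^ level h)%N%:Z * defect h u.
Proof. by rewrite defect_mul defect_self add0r. Qed.

Let defect_mull u : defect h (bsp_mul h u) = defect h u.
Proof. by rewrite defect_mul defect_self mulr0 addr0. Qed.

Let defect_fixed u : (3 ^ level h)%N%:Z * defect h u = defect h u -> defect h u = 0.
Proof. by have := pow3_gt1 h0; rewrite /level; clear; move: (defect _ _); nia. Qed.

Variable g : bsp.
Hypotheses (gS : g \in S) (zg : defect h g <> 0).
Hypothesis (above_g : forall u, u \in S -> (level g < level u)%N -> defect h u = 0).

Let gh' : (level g <= level h')%N.
Proof. by apply: topS => //; apply/eqP => e; apply: zg; rewrite e defect_self. Qed.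

Let gh_hg : bsp_mul g h != bsp_mul h g.
Proof.
apply/eqP => /(congr1 (defect h)); rewrite defect_mulr defect_mull => e.
exact/zg/defect_fixed.
Qed.

Let new_products (l : seq bsp) := [/\ uniq l, size l = 4%N, {subset l <= bsp_sq S} &
    forall u v, u \in rem h S -> v \in rem h S -> bsp_mul u v \notin l].

(** The products [h h] and [h h'] lie above all remaining ones. Remaining factors of a product on
    the level of [g h] both lie above [g], so that product has defect 0, unlike [g h] and [h g]. *)
Let new_below : (level g < level h')%N -> exists l, new_products l.
Proof.
move=> lt; exists [:: bsp_mul h h; bsp_mul h h'; bsp_mul g h; bsp_mul h g]; split=> //.
- by rewrite /= !inE !negb_or gh_hg !andbT !neq_level //; level_lia.
- by apply/allP; rewrite /= !mem_bsp_sq.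
move=> u v /memL[uS' u1] /memL[vS v1].
have z0 : (level u + level v = level g + level h)%N -> defect h (bsp_mul u v) = 0.
  by move=> e; rewrite defect_mul !above_g ?mulr0 //; level_lia.
apply/negP; rewrite !inE => /or4P[] /eqP e; have := congr1 level e => le.
- by move: le; level_lia.
- by move: le; level_lia.
- have /eqP := z0 le; rewrite e defect_mulr mulf_eq0 => /orP[|/eqP//].
  by rewrite gt_eqF // pow3_gt0.
- by apply: zg; rewrite -defect_mull -e z0 // -level_mul le level_mul addnC.
Qed.

(** With [g] on the second highest level, [h h], [g h] and [h g] lie above all remaining products,
    so only a fourth product [w] has to be found. *)
Let new_fourth w : level g = level h' -> w \in bsp_sq S -> (level w < level h + level h)%N ->
   w \notin [:: bsp_mul g h; bsp_mul h g] ->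
   (forall u v, u \in rem h S -> v \in rem h S -> bsp_mul u v != w) ->
   exists l, new_products l.
Proof.
move=> eg w0 wlev wn wL.
exists [:: bsp_mul h h; w; bsp_mul g h; bsp_mul h g]; split=> //.
- have nw : bsp_mul h h != w by apply: neq_level; level_lia.
  by rewrite [uniq _]/= wn !inE !negb_or nw gh_hg !andbT !neq_level //; level_lia.
- by apply/allP; rewrite /= !mem_bsp_sq // w0.
move=> u v uL vL; have [_ u1] := memL uL; have [_ v1] := memL vL.
apply/negP; rewrite !inE => /or4P[] /eqP e; have := congr1 level e.
- by level_lia.
- by move: (wL _ _ uL vL); rewrite e eqxx.
- by level_lia.
- by level_lia.
Qed.

(** One of [g' h] and [h g'] is the fourth product. The first can only coincide with [h g] and the
    second with [g h]; both together would make each of the defects of [g] and [g'] equal to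
    [3 ^ level h] times the other, hence zero. *)
Let new_beside g' : level g = level h' -> g' \in S -> level g' = level g -> g' <> g ->
  exists l, new_products l.
Proof.
move=> eg g'S lg' ng'.
have nz : defect h g' <> defect h g.
  by move=> e; apply: ng'; apply: (@defect_inj h).
have lo u v w : u \in rem h S -> v \in rem h S -> level w = (level h + level g)%N ->
    bsp_mul u v != w.
  by move=> /memL[_ u1] /memL[_ v1] e; apply: neq_level; level_lia.
have [wn|wn] := boolP (bsp_mul g' h \in [:: bsp_mul g h; bsp_mul h g]); last first.
  apply: (@new_fourth (bsp_mul g' h)); rewrite ?mem_bsp_sq //; first by level_lia.
  by move=> u v uL vL; apply: lo => //; level_lia.
apply: (@new_fourth (bsp_mul h g')); rewrite ?mem_bsp_sq //; first by level_lia.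
  have p1 : 1 < (3 ^ level h)%N%:Z by apply: pow3_gt1.
  have e1 : (3 ^ level h)%N%:Z * defect h g' = defect h g.
    move: wn; rewrite !inE => /orP[] /eqP/(congr1 (defect h)).
      by rewrite !defect_mulr => e; case: nz; apply: (@mulfI _ (3 ^ level h)%N%:Z) => //; lia.
    by rewrite defect_mulr defect_mull.
  apply/negP; rewrite !inE => /orP[] /eqP/(congr1 (defect h)); rewrite !defect_mull // defect_mulr -e1.
  move=> e2; apply: nz; rewrite -e1.
  by move: p1 e2; clear; move: (defect _ _) (_ ^ _)%N%:Z; nia.
by move=> u v uL vL; apply: lo => //; level_lia.
Qed.

(** Let [k] be highest below [g]. The only possible remaining product on the level of [k h] is
    [g g], so [k h] or [h k] is new unless both equal [g g]. In that case [k] commutes with [h], so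
    [g g] has defect 0, although its defect is a positive multiple of that of [g]. *)
Let new_lone : level g = level h' -> (forall u, u \in S -> level u = level g -> u = g) ->
  exists l, new_products l.
Proof.
move=> eg lone; have [s0 s0S s0h'] := three.
have [|k] := @exists_highest [seq s <- S | (level s < level g)%N].
  by rewrite -has_filter; apply/hasP; exists s0; rewrite // eg.
rewrite mem_filter => /andP[kg kS] kmax.
have onlyg u : u \in rem h S -> (level k < level u)%N -> u = g.
  move=> /memL[uS' u1] ku; apply: lone => //.
  have := kmax u; rewrite mem_filter uS' andbT => kmaxu.
  by move: u1; rewrite -eg leq_eqVlt => /orP[/eqP//|/kmaxu]; level_lia.
have lo u v : u \in rem h S -> v \in rem h S ->
    (level u + level v = level k + level h)%N -> bsp_mul u v = bsp_mul g g.
  move=> uL vL e; have [_ u1] := memL uL; have [_ v1] := memL vL.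
  have -> : u = g by apply: onlyg uL _; level_lia.
  have -> : v = g by apply: onlyg vL _; level_lia.
  by [].
have zgg : defect h (bsp_mul g g) <> 0.
  rewrite defect_mul; move: zg (pow3_gt0 (level g)); clear.
  by rewrite /level; move: (defect _ _); nia.
have wn w : level w = (level k + level h)%N -> w \notin [:: bsp_mul g h; bsp_mul h g].
  by move=> lw; rewrite !inE !negb_or !neq_level //; level_lia.
have new w : w \in bsp_sq S -> level w = (level k + level h)%N -> w != bsp_mul g g ->
    exists l, new_products l.
  move=> wS lw nw; apply: (@new_fourth w) => //; first by level_lia.
    exact: wn.
  move=> u v uL vL; apply: contraNneq nw => e.
  by rewrite -e; apply/eqP/lo => //; rewrite -lw -e.
have [e|n] := eqVneq (bsp_mul k h) (bsp_mul g g); last first.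
  by apply: (new (bsp_mul k h)); rewrite ?mem_bsp_sq.
apply: (new (bsp_mul h k)); rewrite ?mem_bsp_sq //; first exact: addnC.
apply/eqP => e2; apply: zgg; rewrite -e defect_mulr.
have -> : defect h k = 0 by apply/eqP; rewrite defect_comm e2 -e.
by rewrite mulr0.
Qed.

Lemma single_top_new_from : exists l, new_products l.
Proof.
move: gh'; rewrite leq_eqVlt => /orP[/eqP eg|]; last exact: new_below.
have [/hasP[g' g'S /andP[/eqP lg' /eqP ng']]|/hasPn lone] :=
    boolP (has (fun s => (level s == level g) && (s != g)) S).
  exact: (@new_beside g').
apply: new_lone => // u uS' lu; apply/eqP; have := lone u uS'.
by rewrite lu eqxx negbK.
Qed.

End SingleTop.

Lemma single_top_new (S : seq bsp) (h h' : bsp) : uniq S -> h \in S -> noncommuting S ->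
  h' \in S -> (level h' < level h)%N ->
  (forall s, s \in S -> s != h -> (level s <= level h')%N) ->
  (exists2 s, s \in S & (level s < level h')%N) ->
  (size (bsp_sq (rem h S)) + 4 <= size (bsp_sq S))%N.
Proof.
move=> uS hS ncS h'S h'h topS three.
have h0 : (0 < level h)%N by lia.
have [g0 g0S zg0] := noncommuting_defect h0 ncS.
have [|g] := @exists_highest [seq s <- S | defect h s != 0].
  by rewrite -has_filter; apply/hasP; exists g0.
rewrite mem_filter => /andP[/eqP zg gS] gmax.
have [|l [ul sl lS nl]] := single_top_new_from uS hS h'S h'h topS three gS zg.
  move=> u uS' lt; apply/eqP; have := gmax u; rewrite mem_filter uS' andbT.
  by case: eqP => // _ /(_ isT); level_lia.
rewrite -sl; apply: sq_size_add => //; exact: mem_rem.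
Qed.

(** * Induction *)

(** The products in [l1] lie below [g2 g2], hence below all remaining ones. Those in [l2] have
    nonzero defect relative to [g2], while a remaining product on a level at most that of [g1 h] has
    both factors below [h], hence defect 0. *)
Lemma two_bottom_new (S : seq bsp) (g0 g1 g2 h : bsp) : uniq S ->
  [/\ g0 \in S, g1 \in S, g2 \in S & h \in S] ->
  (level g0 < level g1)%N -> (level g1 < level g2)%N -> (level g2 < level h)%N ->
  (forall s, s \in S -> s != g0 -> s != g1 -> (level g2 <= level s)%N) ->
  (forall s, s \in S -> (level s < level h)%N -> defect g2 s = 0) ->
  defect g2 h <> 0 ->
  (size (bsp_sq (rem g1 (rem g0 S))) + 7 <= size (bsp_sq S))%N.
Proof.
move=> uS [g0S g1S g2S hS] lt01 lt12 lt2h low z0 zh.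
have memL s : s \in rem g1 (rem g0 S) -> s \in S /\ (level g2 <= level s)%N.
  rewrite !(mem_rem_uniq, inE, rem_uniq) // => /and3P[n1 n0 sS].
  by split=> //; apply: low.
have zg0 : defect g2 g0 = 0 by apply: z0 => //; level_lia.
have zg1 : defect g2 g1 = 0 by apply: z0 => //; level_lia.
have zg2 : defect g2 g2 = 0 by apply: defect_self.
have zg1h : defect g2 (bsp_mul g1 h) = defect g2 h by rewrite defect_mul zg1 mulr0 addr0.
have zg0h : defect g2 (bsp_mul g0 h) = defect g2 h by rewrite defect_mul zg0 mulr0 addr0.
have zhg1 : defect g2 (bsp_mul h g1) = (3 ^ level g1)%N%:Z * defect g2 h.
  by rewrite defect_mul zg1 add0r.
have p1 : 1 < (3 ^ level g1)%N%:Z by apply: pow3_gt1; level_lia.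
have zhg1' : defect g2 (bsp_mul h g1) <> 0.
  by rewrite zhg1; move: zh p1; clear; move: (defect _ _) (_ ^ _)%N%:Z; nia.
have nc : bsp_mul g1 h != bsp_mul h g1.
  apply/eqP => /(congr1 (defect g2)); rewrite zg1h zhg1.
  by move: zh p1; clear; move: (defect _ _) (_ ^ _)%N%:Z; nia.
pose l1 := [:: bsp_mul g0 g0; bsp_mul g0 g1; bsp_mul g1 g1; bsp_mul g1 g2].
pose l2 := [:: bsp_mul g0 h; bsp_mul g1 h; bsp_mul h g1].
have zl1 x : x \in l1 -> defect g2 x = 0.
  by rewrite !inE => /or4P[] /eqP->; rewrite defect_mul ?(zg0, zg1, zg2) mulr0.
have zl2 x : x \in l2 -> defect g2 x <> 0.
  by rewrite !inE => /or3P[] /eqP->; rewrite ?zg0h ?zg1h.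
have ll1 x : x \in l1 -> (level x <= level g1 + level g2)%N.
  by rewrite !inE => /or4P[] /eqP->; level_lia.
have ll2 x : x \in l2 -> (level x <= level g1 + level h)%N.
  by rewrite !inE => /or3P[] /eqP->; level_lia.
have -> : 7%N = size (l1 ++ l2) by [].
apply: sq_size_add.
- by move=> s /memL[].
- rewrite cat_uniq; apply/and3P; split.
  + by rewrite /= !inE !negb_or !neq_level //; level_lia.
  + by apply/hasPn => x /zl2 zx; apply/negP => /zl1.
  + by rewrite /= !inE !negb_or nc !neq_level //; level_lia.
- by apply/allP; rewrite /= !mem_bsp_sq.
move=> u v /memL[uS' u2] /memL[vS' v2]; rewrite mem_cat; apply/negP => /orP[].
  by move=> /ll1; level_lia.
move=> uv; have := zl2 _ uv; have := ll2 _ uv => luv; apply.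
by rewrite defect_mul !z0 ?mulr0 //; level_lia.
Qed.

Lemma remove_top_level (S : seq bsp) (h h' : bsp) : uniq S -> noncommuting S -> h \in S -> h' \in S ->
  (level h' < level h)%N ->
  (forall s, s \in S -> (level s <= level h)%N) ->
  (forall s, s \in S -> (level s < level h)%N -> (level s <= level h')%N) ->
  (exists2 s, s \in S & (level s < level h')%N) ->
  (7 * size S + 2 * size (bsp_sq [seq s <- S | (level s < level h)%N]) <=
   7 * size [seq s <- S | (level s < level h)%N] + 2 * size (bsp_sq S))%N.
Proof.
move=> uS ncS hS h'S h'h htop h'top three; set L : seq bsp := [seq s <- S | _].
have h'0 : (0 < level h')%N by case: three => s _; level_lia.
have sS : size S = (size L + size (slice (level h) S))%N.
  rewrite size_map !size_filter -(count_predC (fun s => (level s < level h)%N)).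
  congr addn; apply: eq_in_count => s /htop /=.
  by rewrite -leqNgt eqn_leq => ->.
have nh : slice (level h) S != [::] by apply: slice_neq0.
have nh' : slice (level h') S != [::] by apply: slice_neq0.
have [n1|n1] := ltnP 1 (size (slice (level h) S)).
  have c1 := slice_above_size uS h'h h'0 n1 nh'.
  have c2 : (3 * size (slice (level h) S)
             <= (size (slice (level h + level h) (bsp_sq S))).+2)%N.
    by apply: slice_square_size; rewrite ?(leq_trans h'0) // ltnW.
  have c3 : (size (bsp_sq L) + size (slice (level h + level h') (bsp_sq S))
     + size (slice (level h + level h) (bsp_sq S)) <= size (bsp_sq S))%N.
    (* Products from [L] reach at most twice the level of [h'], strictly below the two slices
       counted here. *)
    pose low := fun s => (level s <= level h' + level h')%N.
    have : (size (bsp_sq L) <= size (filter low (bsp_sq S)))%N.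
      apply: uniq_leq_size (undup_uniq _) _ => x /bsp_sqP[u [v [uL vL ->]]].
      move: uL vL; rewrite !mem_filter => /andP[u1 uS'] /andP[v1 vS].
      rewrite mem_bsp_sq // andbT /low level_mul.
      exact: leq_add (h'top _ uS' u1) (h'top _ vS v1).
    rewrite !size_map !size_filter.
    have : (count low (bsp_sq S) + count (fun s => s.1 == level h + level h')%N (bsp_sq S)
       + count (fun s => s.1 == level h + level h)%N (bsp_sq S) <= size (bsp_sq S))%N.
      elim: (bsp_sq S) => //= s Q; rewrite /low -/(level s); move: h'h; clear; lia.
    by level_lia.
  (* With [n] elements on top, [(3n - 2) + (n + 1) = 4n - 1] is at least [7n/2] because [n >= 2]. *)
  by rewrite sS; move: n1 c1 c2 c3; clear; lia.
have n1' : size (slice (level h) S) = 1%N.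
  by move: n1 nh; case: slice => [|x []].
have eh s : s \in S -> level s = level h -> s = h.
  move=> sS' e.
  have : s.2 \in slice (level h) S by rewrite mem_slice -e /level -surjective_pairing.
  have : h.2 \in slice (level h) S by rewrite mem_slice /level -surjective_pairing.
  case: slice n1' => [|y []] //= _; rewrite !inE => /eqP eh /eqP es.
  by rewrite (surjective_pairing s) (surjective_pairing h) -/(level s) e es eh.
have eL : rem h S = L.
  rewrite rem_filter //; apply: eq_in_filter => s sS' /=.
  rewrite ltn_neqAle htop // andbT; congr negb.
  by apply/eqP/eqP => [->//|]; apply: eh.
have : (size (bsp_sq (rem h S)) + 4 <= size (bsp_sq S))%N.
  apply: (@single_top_new S h h') => // s sS' nsh; apply: h'top => //.
  by rewrite ltn_neqAle htop // andbT; apply: contraNneq nsh => /(eh _ sS')->.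
by rewrite eL sS n1'; clear; lia.
Qed.

Lemma sq_size_bound (S : seq bsp) : uniq S -> noncommuting S ->
  (exists2 s, s \in S & exists2 s', s' \in S & level s != level s') ->
  (7 * size S <= 2 * size (bsp_sq S) + 12)%N.
Proof.
have [n] := ubnP (size S); elim: n S => // n IH S ltn uS ncS [s sS [s' s'S nss']].
have [|h hS htop] := @exists_highest S; first by case: (S) sS.
pose L : seq bsp := [seq s <- S | (level s < level h)%N].
have LS : {subset L <= S} by move=> x; rewrite mem_filter => /andP[].
have uL : uniq L by apply: filter_uniq.
have ltL x : x \in L -> (level x < level h)%N by rewrite mem_filter => /andP[].
have inL x : x \in S -> (level x < level h)%N -> x \in L.
  by rewrite mem_filter => -> ->.
have [|h' h'L h'top] := @exists_highest L.
  rewrite -has_filter; apply/hasP; have := htop _ sS; have := htop _ s'S.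
  have [lt _ _|ge l1 l2] := ltnP (level s) (level h); first by exists s.
  by exists s' => //; move/eqP: nss'; level_lia.
have h'h := ltL _ h'L.
have [/hasP[s0 s0L lt0]|/hasPn two] := boolP (has (fun s => level s < level h')%N L); last first.
  apply: (@two_level_size S (level h') (level h)) => //.
  - by apply: slice_neq0; apply: LS.
  - exact: slice_neq0.
  move=> x xS; have [xh|xh] := ltnP (level x) (level h).
    have xL := inL _ xS xh; have := two _ xL; rewrite -leqNgt => lo.
    by apply/orP; left; rewrite -/(level x) eqn_leq lo h'top.
  by apply/orP; right; rewrite -/(level x) eqn_leq xh htop.
have ltLS : (size L < size S)%N.
  rewrite size_filter -(count_predC (fun s => level s < level h)%N S) -addn1 leq_add2l.
  by rewrite -has_count; apply/hasP; exists h => //=; rewrite ltnn.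
have rec : (7 * size S + 2 * size (bsp_sq L) <= 7 * size L + 2 * size (bsp_sq S))%N.
  apply: (@remove_top_level S h h') => //; first exact: LS.
    by move=> x xS xh; apply/h'top/inL.
  by exists s0 => //; apply: LS.
have [ncL|cL] := boolP (noncommuting L).
  have : (7 * size L <= 2 * size (bsp_sq L) + 12)%N.
    apply: IH => //; first by apply: leq_trans ltLS _.
    by exists s0 => //; exists h' => //; rewrite ltn_eqF.
  by move: rec; clear; lia.
(* For at most two elements in [L], [rec] and one product in the square of [L] suffice:
   [7 * 2 - 2 * 1] is exactly the constant 12. *)
have [sL|sL] := leqP (size L) 2.
  have : (0 < size (bsp_sq L))%N.
    by case: bsp_sq (mem_bsp_sq h'L h'L).
  by move: rec sL; clear; lia.
have [|g0 g0L g0min] := @exists_lowest L; first by case: (L) h'L.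
pose L1 : seq bsp := rem g0 L; have uL1 : uniq L1 by apply: rem_uniq.
have sL1 : size L1 = (size L).-1 by apply: size_rem.
have [|g1 g1L1 g1min] := @exists_lowest L1.
  by rewrite -size_eq0 sL1; move: sL; clear; lia.
pose L2 : seq bsp := rem g1 L1.
have sL2 : size L2 = (size L1).-1 by apply: size_rem.
have [|g2 g2L2 g2min] := @exists_lowest L2.
  by rewrite -size_eq0 sL2 sL1; move: sL; clear; lia.
have /andP[n10 g1L] : (g1 != g0) && (g1 \in L) by move: g1L1; rewrite mem_rem_uniq.
have /and3P[n21 n20 g2L] : [&& g2 != g1, g2 != g0 & g2 \in L].
  by move: g2L2; rewrite mem_rem_uniq // inE mem_rem_uniq.
have h'0 : (0 < level h')%N by level_lia.
(* All of [L] has defect 0 relative to [h'], so an element of [L] is determined by its level. *)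
have inj x y : x \in L -> y \in L -> x != y -> level x <> level y.
  move=> xL yL /eqP nxy e; apply: nxy; apply: (@defect_inj h') => //.
  by rewrite !(commuting_defect cL).
have lt01 : (level g0 < level g1)%N.
  by rewrite ltn_neqAle g0min // andbT eq_sym; apply/eqP/inj.
have lt12 : (level g1 < level g2)%N.
  rewrite ltn_neqAle g1min ?andbT; last exact: mem_rem g2L2.
  by rewrite eq_sym; apply/eqP/inj.
have g20 : (0 < level g2)%N by level_lia.
(* Since [L] commutes, an element not commuting with [g2] must be on the top level; [k] serves as
   the [h] of [two_bottom_new]. *)
have [k kS zk] := noncommuting_defect g20 ncS.
have lk : level k = level h.
  apply/eqP; rewrite eqn_leq htop //= leqNgt; apply: contra zk => lt.
  by rewrite (commuting_defect cL g2L (inL _ kS lt)).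
have new : (size (bsp_sq (rem g1 (rem g0 S))) + 7 <= size (bsp_sq S))%N.
  apply: (@two_bottom_new S g0 g1 g2 k) => //.
  - by split=> //; apply: LS.
  - by rewrite lk ltL.
  - move=> x xS nx0 nx1; have [xh|] := ltnP (level x) (level h); last first.
      by move=> hx; apply: leq_trans hx; apply/ltnW/ltL.
    by apply: g2min; rewrite !mem_rem_uniq // !inE mem_rem_uniq // !inE nx1 nx0 inL.
  - by move=> x xS; rewrite lk => /(inL _ xS)/(commuting_defect cL g2L).
  - exact/eqP.
have [g0S g1S g2S] := And3 (LS _ g0L) (LS _ g1L) (LS _ g2L).
have uS0 : uniq (rem g0 S) by apply: rem_uniq.
have sS' : size (rem g1 (rem g0 S)) = (size S).-2.
  by rewrite size_rem ?size_rem // mem_rem_uniq // !inE n10.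
have inS' x : x \in S -> x != g0 -> x != g1 -> x \in rem g1 (rem g0 S).
  by move=> xS nx0 nx1; rewrite mem_rem_uniq // !inE nx1 mem_rem_uniq // !inE nx0.
have lgk : (level g2 < level k)%N by rewrite lk ltL.
have kS' : k \in rem g1 (rem g0 S).
  by apply: inS' => //; apply: neq_level; level_lia.
have g2S' := inS' _ g2S n20 n21.
(* [g2] and [k] survive the removal and keep the set noncommuting and on two levels. The seven lost
   products pay for the two removed elements at the rate [7/2]. *)
have : (7 * size (rem g1 (rem g0 S)) <= 2 * size (bsp_sq (rem g1 (rem g0 S))) + 12)%N.
  apply: IH; rewrite ?rem_uniq //.
  - by rewrite sS'; move: ltLS ltn; clear; lia.
  - exact: defect_noncommuting zk.
  - by exists g2 => //; exists k => //; rewrite ltn_eqF.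
by rewrite sS'; move: new ltLS sL; clear; lia.
Qed.

Unset Implicit Arguments.

Theorem mainTheorem1 (S : seq bsp) :
  uniq S -> (3 <= size S)%N -> bsp_nonabelian S ->
  (exists2 s, s \in S & exists2 s', s' \in S & s.1 != s'.1) ->
  ((7%:R / 2%:R) * (size S)%:R - 6%:R <= (size (bsp_sq S))%:R :> rat).
Proof.
move=> uS _ /nonabelian_noncommuting ncS lev.
have : ((7 * size S)%:R <= (2 * size (bsp_sq S) + 12)%:R :> rat).
  by rewrite ler_nat; apply: sq_size_bound.
by rewrite natrD !natrM; lra.
Qed.
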